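(* Let $M$ be a commutative monoid and $a \in M$. (1) $\mathrm{sr}_M(ka) \ge \mathrm{sr}_M(la)$ for all positive integers $k \le l$. (2) If $\mathrm{sr}_M(a)$ is finite, then $\mathrm{sr}_M(ka) \le 2$ for all positive integers $k \ge \mathrm{sr}_M(a) - 1$.
   Context: All monoids are commutative and written additively. For a monoid $M$ and $a \in M$, the stable rank $\mathrm{sr}_M(a) \in \mathbb{Z}_{>0} \cup \{\infty\}$ is the least positive integer $n$ such that: for all $x,y \in M$ with $na + x = a + y$ there exists $e \in M$ with $na = a + e$ and $e + x = y$. If no such $n$ exists, $\mathrm{sr}_M(a) = \infty$. Values are compared in the usual order with $n < \infty$ for all integers $n$. *)

(* Defs.v *)
From mathcomp Require Import all_boot all_order all_algebra.
From mathcomp Require Import boolp constructive_ereal.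

Set Implicit Arguments.
Unset Strict Implicit.
Unset Printing Implicit Defensive.

Import Order.TTheory GRing.Theory Num.Theory.

Local Open Scope ring_scope.

Definition stable_rank_condition (M : nmodType) (a : M) (n : nat) : Prop :=
  forall x y : M, a *+ n + x = a + y ->
    exists e : M, a *+ n = a + e /\ e + x = y.

(* The value lies in Z_{>0} together with +oo, viewed inside the extended
   integers so as to inherit their order and arithmetic; -oo is never taken. *)
Definition stable_rank (M : nmodType) (a : M) : \bar int :=
  match pselect (exists n : nat,
                   (0 < n)%N && `[< stable_rank_condition a n >]) with
  | left ex_n => ((ex_minn ex_n)%:Z)%:E
  | right _ => +oo%E
  end.

(* Main.v *)
(* Writing C(a, n) for the stable rank condition, everything rests on one move:
   an instance n a + x' = a + y' of C(a, n) yields e with a + e = n a, and adding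
   enough copies of a turns e back into n a, so that one copy of a cancels from
   both sides of the equation one started with. Part (1) performs this once, to
   go from C(k a, n) to C((k+1) a, n); part (2) uses C(a, k+1), iterating to
   reduce 2k a + x = k a + y to (k+1) a + x = a + y. *)
Require Import Defs.
From mathcomp Require Import all_boot all_order all_algebra.
From mathcomp Require Import boolp constructive_ereal.

Set Implicit Arguments.
Unset Strict Implicit.
Unset Printing Implicit Defensive.

Import Order.TTheory GRing.Theory Num.Theory.

Local Open Scope ring_scope.

(** The extra copy of [a] is absorbed into [x], and the witness grows from [e] to [e + a]. *)
Lemma stable_rank_conditionS (M : nmodType) (a : M) n :
  stable_rank_condition a n -> stable_rank_condition a n.+1.
Proof.
move=> Ca x y; rewrite mulrSr -addrA => /Ca[e [ae exy]].
exists (e + a); split; first by rewrite addrA -ae.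
by rewrite -addrA.
Qed.

Lemma stable_rank_condition_leq (M : nmodType) (a : M) m n : (m <= n)%N ->
  stable_rank_condition a m -> stable_rank_condition a n.
Proof.
move=> /subnK <- Ca; elim: (n - m)%N => [|d IHd] //=.
exact: stable_rank_conditionS.
Qed.

Lemma stable_rank_condition_mulrnS (M : nmodType) (a : M) k n :
  (0 < k)%N -> (0 < n)%N ->
  stable_rank_condition (a *+ k) n -> stable_rank_condition (a *+ k.+1) n.
Proof.
case: k n => [//|k] [//|n] _ _ Ck x y Exy.
(* Each [a *+ k.+2] gives up one [a]: [n.+1] copies join [x], one joins [y]. *)
have [e [ke exy]] : exists e, a *+ k.+1 *+ n.+1 = a *+ k.+1 + e /\
    e + (a *+ n.+1 + x) = a + y.
  by apply: Ck; rewrite !addrA -mulrnDl -!mulrSr Exy.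
have [f [kf fxy]] : exists f, a *+ k.+1 *+ n.+1 = a *+ k.+1 + f /\
    f + (a *+ n + x) = y.
  (* One [a] out of [a *+ k.+1] completes [a *+ n] to [a *+ n.+1], so that [exy] applies. *)
  apply: Ck; rewrite ke [in RHS]mulrSr -[RHS]addrA -exy.
  by rewrite mulrSr (mulrS a n) -!addrA; congr (_ + _); rewrite addrCA.
exists (f + a *+ n); split; last by rewrite -addrA.
by rewrite (mulrSr a k.+1) mulrnDl kf (mulrS a n) -!addrA (addrCA f).
Qed.

Lemma stable_rank_condition_mulrn_leq (M : nmodType) (a : M) k l n :
  (0 < k)%N -> (0 < n)%N -> (k <= l)%N ->
  stable_rank_condition (a *+ k) n -> stable_rank_condition (a *+ l) n.
Proof.
move=> k0 n0 /subnK <- Ck; elim: (l - k)%N => [|d IHd] //.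
by apply: stable_rank_condition_mulrnS; rewrite // addn_gt0 k0 orbT.
Qed.

Lemma stable_rank_condition_cancel (M : nmodType) (a : M) k j x y :
  stable_rank_condition a k.+1 ->
  a *+ (k + j.+1) + x = a *+ j.+1 + y -> a *+ k.+1 + x = a + y.
Proof.
move=> Ca; elim: j => [|j IHj] Exy; first by rewrite -addn1.
have [e [ae exy]] : exists e, a *+ k.+1 = a + e /\
    e + (a *+ j.+1 + x) = a *+ j.+1 + y.
  by apply: Ca; rewrite !addrA -mulrnDr -mulrS addSnnS.
(* One [a] from [a *+ j.+1] merges with [e] into [a *+ k.+1], which gives the equation for [j]. *)
apply: IHj; rewrite -exy (mulrS a j) !addrA [e + a]addrC -ae -mulrnDr.
by rewrite addSnnS.
Qed.

Lemma stable_rank_condition_mulrn2 (M : nmodType) (a : M) k : (0 < k)%N ->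
  stable_rank_condition a k.+1 -> stable_rank_condition (a *+ k) 2.
Proof.
case: k => [//|k] _ Ca x y; rewrite mulr2n -mulrnDr.
move=> /(stable_rank_condition_cancel Ca)/Ca[e [ae exy]].
(* The witness for [a] also serves [a *+ k.+1]: add [k] copies of [a] to [a *+ k.+2 = a + e]. *)
exists e; split=> //.
by rewrite (mulrSr a k) -addrA -ae -mulrnDr addSnnS.
Qed.

(** Records that a finite value satisfies the condition; minimality enters through
    [stable_rank_le]. *)
Variant stable_rank_spec (M : nmodType) (a : M) : \bar int -> Prop :=
| StableRankFin n of (0 < n)%N & stable_rank_condition a n :
    stable_rank_spec a (n%:Z)%:E
| StableRankInf : stable_rank_spec a +oo%E.

Lemma stable_rankP (M : nmodType) (a : M) :
  stable_rank_spec a (stable_rank a).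
Proof.
rewrite /stable_rank; case: pselect => [ex_n|_]; last exact: StableRankInf.
by case: ex_minnP => n /andP[n0 /asboolP Ca] _; apply: StableRankFin.
Qed.

Lemma stable_rank_le (M : nmodType) (a : M) n : (0 < n)%N ->
  stable_rank_condition a n -> (stable_rank a <= (n%:Z)%:E)%E.
Proof.
move=> n0 Ca; have Pn : (0 < n)%N && `[< stable_rank_condition a n >].
  by rewrite n0; apply/asboolP.
rewrite /stable_rank; case: pselect => [ex_n|[]]; last by exists n.
by case: ex_minnP => m _ /(_ _ Pn); rewrite lee_fin lez_nat.
Qed.

Theorem propositionA (M : nmodType) (a : M) :
  (forall k l : nat, (0 < k)%N -> (0 < l)%N -> (k <= l)%N ->
     (stable_rank (a *+ k) >= stable_rank (a *+ l))%E)
  /\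
  ((stable_rank a < +oo)%E ->
     forall k : nat, (0 < k)%N ->
       ((k%:Z)%:E >= stable_rank a - 1)%E ->
       (stable_rank (a *+ k) <= 2%:E)%E).
Proof.
split=> [k l k0 _ kl|fin_a k k0].
  case: (stable_rankP (a *+ k)) => [n n0 Ck|]; last exact: leey.
  exact/stable_rank_le/(stable_rank_condition_mulrn_leq k0 n0 kl).
case: (stable_rankP a) fin_a => [n n0 Ca _|]; last by rewrite ltxx.
(* The bound becomes [n <= k.+1], so the condition at [n] passes up to [k.+1]. *)
rewrite -EFinB lee_fin lerBlDr -PoszD lez_nat addn1 => nk.
apply: (@stable_rank_le _ _ 2) => //.
exact/stable_rank_condition_mulrn2/(stable_rank_condition_leq nk).
Qed.
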